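(* Let $\mathcal{M}$ and $\mathcal{N}$ be qubit channels, i.e. CPTP maps from operators on $\mathbb{C}^2$ to operators on $\mathbb{C}^2$. Then $$\mathrm{cv}(\mathcal{M}\otimes\mathcal{N})=\mathrm{cv}(\mathcal{M})\,\mathrm{cv}(\mathcal{N}).$$
   Context: Communication value: for a classical channel with transition probabilities $P(y|x)$, $x\in[n]$, $y\in[n']$, put $\mathrm{cv}(\mathbf{P})=\sum_{y\in[n']}\max_{x\in[n]}P(y|x)$. For a quantum channel (CPTP map) $\mathcal{N}$, $\mathrm{cv}(\mathcal{N})$ is the supremum, over all $n,n'\in\mathbb{N}$, all density operators $\rho_1,\dots,\rho_n$ on the input space and all POVMs $\{\Pi_y\}_{y=1}^{n'}$ on the output space, of $\mathrm{cv}(\mathbf{P})$ with $P(y|x)=\mathrm{Tr}[\Pi_y\mathcal{N}(\rho_x)]$. For a tensor product channel, arbitrary (possibly entangled) states and joint POVMs on the composite input and output spaces are allowed. *)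

(* Defs.v *)
From HB Require Import structures.
From mathcomp Require Import all_boot all_order all_algebra.
From mathcomp Require Import complex mxtens.
From mathcomp Require Import all_classical all_reals all_analysis.

Set Implicit Arguments.
Unset Strict Implicit.
Unset Printing Implicit Defensive.

Import Order.TTheory GRing.Theory Num.Theory.
Local Open Scope ring_scope.
Local Open Scope sesquilinear_scope.
Local Open Scope complex_scope.

Section Operators.
Variable R : realType.
Local Notation C := R[i].

(* In the partial order of R[i], 0 <= z means that z is real and nonnegative;
   hence the condition forces A to be Hermitian. *)
Definition psdmx (n : nat) (A : 'M[C]_n) : Prop :=
  forall v : 'cV[C]_n, 0 <= (v ^t* *m A *m v) 0 0.

Definition density (n : nat) (rho : 'M[C]_n) : Prop :=
  psdmx rho /\ \tr rho = 1.

Definition povm (n k : nat) (Pi : 'I_k -> 'M[C]_n) : Prop :=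
  (forall y, psdmx (Pi y)) /\ \sum_y Pi y = 1%:M.

(* The composite space C^m (x) C^p is C^(m * p), where the basis vector
   e_i (x) e_k has index mxtens_index (i, k); on this space *t is the Kronecker
   product. The tensor product of two linear maps is the linear map determined
   by E_ij (x) E_kl |-> f E_ij (x) g E_kl on matrix units. *)
Definition tenslin (m n p q : nat)
    (f : {linear 'M[C]_m -> 'M[C]_n}) (g : {linear 'M[C]_p -> 'M[C]_q})
    (X : 'M[C]_(m * p)) : 'M[C]_(n * q) :=
  \sum_(i < m) \sum_(j < m) \sum_(k < p) \sum_(l < p)
    X (mxtens_index (i, k)) (mxtens_index (j, l)) *:
      (f (delta_mx i j) *t g (delta_mx k l)).

Lemma tenslin_is_linear (m n p q : nat)
    (f : {linear 'M[C]_m -> 'M[C]_n}) (g : {linear 'M[C]_p -> 'M[C]_q}) :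
  linear (tenslin f g).
Proof.
move=> a X Y; rewrite /tenslin.
do 4! (rewrite scaler_sumr -big_split; apply: eq_bigr => ? _ /=).
by rewrite !mxE scalerDl scalerA.
Qed.

HB.instance Definition _ (m n p q : nat)
    (f : {linear 'M[C]_m -> 'M[C]_n}) (g : {linear 'M[C]_p -> 'M[C]_q}) :=
  GRing.isLinear.Build C 'M[C]_(m * p) 'M[C]_(n * q) _ (tenslin f g)
    (tenslin_is_linear f g).

Lemma tenslinE (m n p q : nat)
    (f : {linear 'M[C]_m -> 'M[C]_n}) (g : {linear 'M[C]_p -> 'M[C]_q})
    (A : 'M[C]_m) (B : 'M[C]_p) :
  tenslin f g (A *t B) = f A *t g B.
Proof.
rewrite [in RHS](matrix_sum_delta A) [in RHS](matrix_sum_delta B) !linear_sum.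
apply/matrixP => a b; rewrite /tenslin !(mxE, summxE) mulr_suml.
apply: eq_bigr => i _; rewrite linear_sum !(mxE, summxE) mulr_suml.
apply: eq_bigr => j _; rewrite linearZ !mxE mulr_sumr !summxE.
apply: eq_bigr => k _; rewrite linear_sum !summxE mulr_sumr.
apply: eq_bigr => l _.
by rewrite tensmxE linearZ !mxE mulrACA.
Qed.

Definition completely_positive (m n : nat)
    (f : {linear 'M[C]_m -> 'M[C]_n}) : Prop :=
  forall (k : nat) (X : 'M[C]_(k * m)),
    psdmx X -> psdmx (tenslin (idfun : {linear 'M[C]_k -> 'M[C]_k}) f X).

Definition trace_preserving (m n : nat)
    (f : {linear 'M[C]_m -> 'M[C]_n}) : Prop :=
  forall X : 'M[C]_m, \tr (f X) = \tr X.

Definition cptp (m n : nat) (f : {linear 'M[C]_m -> 'M[C]_n}) : Prop :=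
  completely_positive f /\ trace_preserving f.

(* A classical channel has a nonempty input alphabet, whence 'I_n.+1; starting
   the iterated maximum from the value at the first input makes it exact. *)
Definition classical_cv (n k : nat) (P : 'I_k -> 'I_n.+1 -> R) : R :=
  \sum_(y < k) \big[Num.max/P y ord0]_(x < n.+1) P y x.

(* For a channel f, density operators and POVM elements, the trace is real;
   Re then only moves it from R[i] to R. *)
Definition transition (m n a k : nat) (f : {linear 'M[C]_m -> 'M[C]_n})
    (rho : 'I_a -> 'M[C]_m) (Pi : 'I_k -> 'M[C]_n) (y : 'I_k) (x : 'I_a) : R :=
  complex.Re (\tr (Pi y *m f (rho x))).

Definition cv (m n : nat) (f : {linear 'M[C]_m -> 'M[C]_n}) : \bar R :=
  ereal_sup [set c : \bar R | exists (a k : nat)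
    (rho : 'I_a.+1 -> 'M[C]_m) (Pi : 'I_k -> 'M[C]_n),
    [/\ forall x, density (rho x), povm Pi &
        c = (classical_cv (transition f rho Pi))%:E]]%classic.

End Operators.

(* Main.v *)
Require Import Defs.
From HB Require Import structures.
From mathcomp Require Import all_boot all_order all_algebra.
From mathcomp Require Import complex mxtens.
From mathcomp Require Import all_classical all_reals all_analysis.
From mathcomp Require Import ring lra.

(* Call Z an upper bound for f if Tr(rho) Z - f(rho) is positive for every
   positive rho; then cv f <= Tr Z.

   For a qubit channel f this bound is attained. Using the antipodal inputs
   rho, 1 - rho with the effects Pi, 1 - Pi gives
   1 + 2 Tr(Pi f(rho)) - Tr(Pi f(1)) <= cv f, so that
   Z = f(1) / 2 + (cv f - 1) / 2 is an upper bound, of trace cv f.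

   If Y and Z are upper bounds for f and g, then Y (x) Z is one for f (x) g:
   writing L- = Tr(.) Z - g, L+ = Tr(.) Z + g, and K-, K+ likewise for f, one has
   2 (Tr(.) Y (x) Z - f (x) g) = K- (x) L+ + K+ (x) L-.
   Here K- and L- are merely positive, but K+ and L+ are entanglement breaking,
   so both terms are positive. Indeed, if D_a denotes dephasing in the
   eigenbasis of the Pauli matrix a, then
   rho = D_x(rho) + D_y(rho) - sum_k <k|rho|k> |1-k><1-k|, whence
   L+(rho) = g(D_x(rho)) + g(D_y(rho)) + sum_k <k|rho|k> (Z - g(|1-k><1-k|)),
   a measure-and-prepare map. *)

Set Implicit Arguments.
Unset Strict Implicit.
Unset Printing Implicit Defensive.

Import Order.TTheory GRing.Theory Num.Theory.
Local Open Scope ring_scope.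
Local Open Scope sesquilinear_scope.
Local Open Scope complex_scope.

Section CommunicationValue.
Variable R : realType.
Local Notation C := R[i].

(** * Positive semidefinite matrices *)

Lemma adjmx_mul m n p (A : 'M[C]_(m, n)) (B : 'M[C]_(n, p)) :
  (A *m B)^t* = B^t* *m A^t*.
Proof. by rewrite trmx_mul map_mxM. Qed.

Lemma adjmxE m n (A : 'M[C]_(m, n)) i j : (A^t* ) i j = ((A j i)^*)%R.
Proof. by rewrite !mxE. Qed.

Lemma adjmxD m n (A B : 'M[C]_(m, n)) : (A + B)^t* = A^t* + B^t*.
Proof. by apply/matrixP => i j; rewrite !mxE rmorphD. Qed.

Lemma adjmxZ m n a (A : 'M[C]_(m, n)) : (a *: A)^t* = (a^*)%R *: A^t*.
Proof. by apply/matrixP => i j; rewrite !mxE rmorphM. Qed.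

(** Polarization over the complex numbers: expanding at [u + v] and at [u + 'i v] kills the
    symmetric and the antisymmetric part of the sesquilinear form. *)
Lemma mx_eq0_form n (B : 'M[C]_n) :
  (forall v : 'cV[C]_n, (v ^t* *m B *m v) 0 0 = 0) -> B = 0.
Proof.
move=> B0.
pose h (u v : 'cV[C]_n) := (u^t* *m B *m v) 0 0.
have h0 v : h v v = 0 by exact: B0.
have polar (u v : 'cV[C]_n) : h u v + h v u = 0.
  have hD : h (u + v) (u + v) = h u u + h v u + (h u v + h v v).
    rewrite /h adjmxD !(mulmxDl, mulmxDr) mxE.
    by rewrite [X in X + _]mxE [X in _ + X]mxE.
  by move: hD; rewrite !h0 add0r addr0 addrC.
have Bij0 (u v : 'cV[C]_n) : (u^t* *m B *m v) 0 0 = 0.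
  have := polar u ('i%R *: v); rewrite /h adjmxZ -!scalemxAr -!scalemxAl.
  rewrite [X in X + _ = _]mxE [X in _ + X = _]mxE conjCi mulNr -mulrBr => /eqP.
  rewrite mulf_eq0 (negbTE (neq0Ci _)) subr_eq0 /= => /eqP uv.
  by have /eqP := polar u v; rewrite /h -uv -mulr2n mulrn_eq0 => /eqP.
apply/matrixP => i j; rewrite [RHS]mxE -(Bij0 (delta_mx i 0) (delta_mx j 0)).
by rewrite trmx_delta map_delta_mx -rowE -colE !mxE.
Qed.

(** The form of the adjoint is the conjugate of the form, and a nonnegative element of [R[i]] is
    real. *)
Lemma psdmx_hermitian n (A : 'M[C]_n) : psdmx A -> A^t* = A.
Proof.
move=> A0; apply/eqP; rewrite -subr_eq0; apply/eqP/mx_eq0_form => v.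
rewrite mulmxBr mulmxBl mxE [X in _ + X]mxE.
have -> : v^t* *m A^t* *m v = (v^t* *m A *m v)^t*.
  by rewrite !adjmx_mul trmxCK mulmxA.
rewrite adjmxE.
by apply/eqP; rewrite subr_eq0; apply/eqP/CrealP/ger0_real/A0.
Qed.

Lemma psdmx_congr m n (V : 'M[C]_(m, n)) (A : 'M[C]_m) :
  psdmx A -> psdmx (V^t* *m A *m V).
Proof.
by move=> A0 v; have := A0 (V *m v); rewrite adjmx_mul !mulmxA.
Qed.

Lemma psdmx_gram m n (V : 'M[C]_(m, n)) : psdmx (V^t* *m V).
Proof.
move=> v; rewrite mulmxA -adjmx_mul -mulmxA mxE sumr_ge0 // => i _.
by rewrite !mxE mulrC mul_conjC_ge0.
Qed.

(** Spectral theorem: [V] is the root of the eigenvalue matrix times the diagonalising unitary; each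
    eigenvalue is the form of [A] at an eigenvector. *)
Lemma psdmx_sqrt n (A : 'M[C]_n) : psdmx A -> exists V : 'M[C]_n, A = V^t* *m V.
Proof.
move=> A0; have hA : A \is hermsymmx.
  by apply/is_hermitianmxP; rewrite expr0 scale1r -{1}(psdmx_hermitian A0).
have /orthomx_spectralP := hermitian_normalmx hA.
set U := spectralmx A; set D := spectral_diag A => AE.
have Uu : U \is unitarymx by exact: spectral_unitarymx.
rewrite (invmx_unitary Uu) in AE.
have D0 i : 0 <= D 0 i.
  have -> : D 0 i = (U *m A *m U^t*) i i.
    rewrite AE !mulmxA (unitarymxP Uu) mul1mx -mulmxA (unitarymxP Uu) mulmx1.
    by rewrite mxE eqxx mulr1n.
  have := A0 (U^t* *m delta_mx i 0).
  by rewrite adjmx_mul trmxCK trmx_delta map_delta_mx !mulmxA -colE -!mulmxA -rowE !mxE.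
exists (diag_mx (\row_i sqrtC (D 0 i)) *m U).
rewrite adjmx_mul mulmxA {1}AE; congr (_ *m _); rewrite -mulmxA; congr (_ *m _).
rewrite tr_diag_mx map_diag_mx mulmx_diag; congr diag_mx; apply/rowP => i.
by rewrite !mxE /= conj_Creal ?ger0_real ?sqrtC_ge0 // -expr2 sqrtCK.
Qed.

Lemma psdmxD n (A B : 'M[C]_n) : psdmx A -> psdmx B -> psdmx (A + B).
Proof. by move=> A0 B0 v; rewrite mulmxDr mulmxDl mxE addr_ge0. Qed.

Lemma psdmxZ n (a : C) (A : 'M[C]_n) : 0 <= a -> psdmx A -> psdmx (a *: A).
Proof. by move=> a0 A0 v; rewrite -scalemxAr -scalemxAl mxE mulr_ge0. Qed.

Lemma psdmx_sum n (I : finType) (F : I -> 'M[C]_n) :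
  (forall i, psdmx (F i)) -> psdmx (\sum_i F i).
Proof.
move=> F0; elim/big_ind: _ => [v|A B A0 B0|i _]; last exact: F0.
  by rewrite mulmx0 mul0mx mxE.
exact: psdmxD.
Qed.

(** Writing [A] as a Gram matrix of [V] and using cyclicity, the trace becomes a sum of values of
    the form of [B] at the columns of [V^t*]. *)
Lemma psdmx_mxtrace_mul n (A B : 'M[C]_n) : psdmx A -> psdmx B -> 0 <= \tr (A *m B).
Proof.
move=> /psdmx_sqrt[V ->] B0; rewrite -mulmxA mxtrace_mulC sumr_ge0 // => i _.
have := B0 (V^t* *m delta_mx i 0).
by rewrite adjmx_mul trmxCK trmx_delta map_delta_mx !mulmxA -colE -!mulmxA -rowE !mxE.
Qed.

Lemma psdmx_tens m n (A : 'M[C]_m) (B : 'M[C]_n) :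
  psdmx A -> psdmx B -> psdmx (A *t B).
Proof.
move=> /psdmx_sqrt[V ->] /psdmx_sqrt[W ->].
by rewrite -tensmx_mul -map_mxT -trmx_tens; apply: psdmx_gram.
Qed.

Lemma mxtrace_tens m n (A : 'M[C]_m) (B : 'M[C]_n) : \tr (A *t B) = \tr A * \tr B.
Proof.
by rewrite /mxtrace mulr_sum; apply: eq_bigr => k _; rewrite mxE.
Qed.

(** Lets identities between linear maps be checked on product operators: each matrix unit of the
    composite space is a product of matrix units. *)
Lemma tensmx_ind m n p q (P : 'M[C]_(m * p, n * q) -> Prop) :
  P 0 -> (forall a X Y, P X -> P Y -> P (a *: X + Y)) ->
  (forall A B, P (A *t B)) -> forall X, P X.
Proof.
move=> P0 PD PT X; rewrite (matrix_sum_delta X).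
elim/big_ind: _ => // [Y Z PY PZ|i _]; first by rewrite -[Y]scale1r; apply: PD.
elim/big_ind: _ => // [Y Z PY PZ|j _]; first by rewrite -[Y]scale1r; apply: PD.
rewrite -[_ *: _]addr0; apply: PD => //.
case: (mxtens_indexP i) => i1 i2; case: (mxtens_indexP j) => j1 j2.
have -> : delta_mx (mxtens_index (i1, i2)) (mxtens_index (j1, j2)) =
    delta_mx i1 j1 *t delta_mx i2 j2 :> 'M[C]_(_, _).
  apply/matrixP => k l; case: (mxtens_indexP k) => k1 k2.
  case: (mxtens_indexP l) => l1 l2.
  rewrite tensmxE !mxE !(can_eq (@mxtens_indexK _ _)) !xpair_eqE.
  by rewrite -natrM mulnb andbACA.
exact: PT.
Qed.

Lemma psdmx_diag n (A : 'M[C]_n) i : psdmx A -> 0 <= A i i.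
Proof.
by move=> /(_ (delta_mx i 0)); rewrite trmx_delta map_delta_mx -rowE -colE !mxE.
Qed.

Lemma mxtrace_delta n (i : 'I_n) : \tr (delta_mx i i : 'M[C]_n) = 1.
Proof.
rewrite -(mul_delta_mx (0 : 'I_1)) mxtrace_mulC mul_delta_mx /mxtrace big_ord1.
by rewrite mxE !eqxx.
Qed.

Lemma psdmx1 n : psdmx (1%:M : 'M[C]_n).
Proof. by have := @psdmx_gram n n 1%:M; rewrite trmx1 map_mx1 mulmx1. Qed.

Lemma psdmx_cast m n (e : m = n) (A : 'M[C]_m) :
  psdmx A -> psdmx (castmx (e, e) A).
Proof. by case: n / e. Qed.

(* The form of Tr A - A at w is the form of A at a vector orthogonal to w. *)
Lemma psdmx_mxtrace_sub (A : 'M[C]_2) : psdmx A -> psdmx (\tr A *: 1%:M - A).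
Proof.
move=> A0 w.
pose u : 'cV[C]_2 := \col_i if i == 0 then - (w 1 0)^*%R else (w 0 0)^*%R.
have := A0 u; congr (0 <= _).
rewrite /mxtrace !mxE !big_ord_recl !big_ord0 !mxE !big_ord_recl !big_ord0 !mxE /=.
have -> : lift ord0 ord0 = 1 :> 'I_2 by apply/val_inj.
rewrite (_ : ord0 = 0) //. rewrite ?eqxx /= ?rmorphN /= ?conjCK.
ring.
Qed.

(** Here Tr A - A is -A, so the form of [A] has both signs. *)
Lemma psdmx_tr0 (A : 'M[C]_2) : psdmx A -> \tr A = 0 -> A = 0.
Proof.
move=> A0 trA; apply: mx_eq0_form => v; apply/eqP.
rewrite eq_le A0 andbT; have := psdmx_mxtrace_sub A0 v.
by rewrite trA scale0r sub0r mulmxN mulNmx mxE oppr_ge0.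
Qed.

(** Complete positivity with a one-dimensional ancilla; compressing by 1 (x) v leaves a single
    diagonal entry. *)
Lemma cp_psdmx m n (f : {linear 'M[C]_m -> 'M[C]_n}) (A : 'M[C]_m) :
  completely_positive f -> psdmx A -> psdmx (f A).
Proof.
move=> cpf A0 v; have := cpf 1%N _ (psdmx_tens (@psdmx1 1) A0).
rewrite tenslinE => /(psdmx_congr ((1%:M : 'M[C]_1) *t v)).
rewrite trmx_tens map_mxT !tensmx_mul => /(psdmx_diag (mxtens_index (0, 0))).
by rewrite tensmxE /= trmx1 map_mx1 !mul1mx mxE eqxx mul1r.
Qed.

(** * Measure-and-prepare maps *)

(** What remains on the first factor when the second is projected onto [w], without normalisation;
    the cast drops the one-dimensional factor in [m * 1]. *)
Definition contractr m p (w : 'cV[C]_p) (X : 'M[C]_(m * p)) : 'M[C]_m :=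
  castmx (muln1 m, muln1 m) ((1%:M *t w)^t* *m X *m (1%:M *t w)).

Definition contractl m p (w : 'cV[C]_m) (X : 'M[C]_(m * p)) : 'M[C]_p :=
  castmx (mul1n p, mul1n p) ((w *t 1%:M)^t* *m X *m (w *t 1%:M)).

Lemma castmx_is_linear m n (e : m = n) : linear (fun A : 'M[C]_m => castmx (e, e) A).
Proof. by case: n / e. Qed.

Lemma contractr_is_linear m p w : linear (@contractr m p w).
Proof.
move=> a X Y; rewrite /contractr mulmxDr mulmxDl -scalemxAr -scalemxAl.
exact: castmx_is_linear.
Qed.

Lemma contractl_is_linear m p w : linear (@contractl m p w).
Proof.
move=> a X Y; rewrite /contractl mulmxDr mulmxDl -scalemxAr -scalemxAl.
exact: castmx_is_linear.
Qed.

HB.instance Definition _ m p w := GRing.isLinear.Build C 'M[C]_(m * p) 'M[C]_m _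
  (@contractr m p w) (contractr_is_linear w).
HB.instance Definition _ m p w := GRing.isLinear.Build C 'M[C]_(m * p) 'M[C]_p _
  (@contractl m p w) (contractl_is_linear w).

Lemma contractr_tens m p (w : 'cV[C]_p) (A : 'M[C]_m) (B : 'M[C]_p) :
  contractr w (A *t B) = (w^t* *m B *m w) 0 0 *: A.
Proof.
rewrite /contractr trmx_tens map_mxT !tensmx_mul trmx1 map_mx1 mul1mx mulmx1.
by rewrite [X in _ *t X]mx11_scalar tens_mx_scalar castmxKV.

Qed.

Lemma contractl_tens m p (w : 'cV[C]_m) (A : 'M[C]_m) (B : 'M[C]_p) :
  contractl w (A *t B) = (w^t* *m A *m w) 0 0 *: B.
Proof.
rewrite /contractl trmx_tens map_mxT !tensmx_mul trmx1 map_mx1 mul1mx mulmx1.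
by rewrite [X in X *t _]mx11_scalar tens_scalar_mx castmxKV.

Qed.

Lemma psdmx_contractr m p (w : 'cV[C]_p) (X : 'M[C]_(m * p)) :
  psdmx X -> psdmx (contractr w X).
Proof. by move=> X0; apply/psdmx_cast/psdmx_congr. Qed.

Lemma psdmx_contractl m p (w : 'cV[C]_m) (X : 'M[C]_(m * p)) :
  psdmx X -> psdmx (contractl w X).
Proof. by move=> X0; apply/psdmx_cast/psdmx_congr. Qed.

Definition positive m n (f : 'M[C]_m -> 'M[C]_n) :=
  forall A, psdmx A -> psdmx (f A).

(** Holevo form of an entanglement-breaking map: measure the effects |w_i><w_i|, prepare [om i]. No
    normalisation is imposed on either. *)
Definition measure_prepare m n (I : finType) (w : I -> 'cV[C]_m)
    (om : I -> 'M[C]_n) (A : 'M[C]_m) : 'M[C]_n :=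
  \sum_i ((w i)^t* *m A *m w i) 0 0 *: om i.

Lemma tensmxDl m n p q (A A' : 'M[C]_(m, n)) (B : 'M[C]_(p, q)) :
  (A + A') *t B = A *t B + A' *t B.
Proof. by apply/matrixP => i j; rewrite !mxE mulrDl. Qed.

Lemma tensmxDr m n p q (A : 'M[C]_(m, n)) (B B' : 'M[C]_(p, q)) :
  A *t (B + B') = A *t B + A *t B'.
Proof. by apply/matrixP => i j; rewrite !mxE mulrDr. Qed.

Lemma tensmxZl m n p q a (A : 'M[C]_(m, n)) (B : 'M[C]_(p, q)) :
  (a *: A) *t B = a *: (A *t B).
Proof. by apply/matrixP => i j; rewrite !mxE mulrA. Qed.

Lemma tensmxZr m n p q a (A : 'M[C]_(m, n)) (B : 'M[C]_(p, q)) :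
  A *t (a *: B) = a *: (A *t B).
Proof. by apply/matrixP => i j; rewrite !mxE mulrCA. Qed.

(** Measuring the second factor turns the output into a sum of products, with [f] acting only on the
    positive operators [contractr (w i) X]. *)
Lemma tenslin_measure_prepare_r m n p q (f : {linear 'M[C]_m -> 'M[C]_n})
    (g : {linear 'M[C]_p -> 'M[C]_q}) (I : finType) (w : I -> 'cV[C]_p) om :
  positive f -> (forall i, psdmx (om i)) -> g =1 measure_prepare w om ->
  positive (tenslin f g).
Proof.
move=> f0 om0 gE X X0.
have -> : tenslin f g X = \sum_i f (contractr (w i) X) *t om i.
  elim/tensmx_ind: {X0} X => [|a X Y EX EY|A B].
  - by rewrite linear0 big1 // => i _; rewrite !linear0 tens0mx.
  - rewrite (tenslin_is_linear f g a X Y) EX EY scaler_sumr -big_split.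
    apply: eq_bigr => i _ /=; by rewrite !linearP tensmxDl tensmxZl.
  - rewrite tenslinE gE (big_morph (tensmx (f A)) (tensmxDr _) (tensmx0 _)).
    by apply: eq_bigr => i _; rewrite contractr_tens linearZ tensmxZl tensmxZr.
by apply: psdmx_sum => i; apply: psdmx_tens => //; apply/f0/psdmx_contractr.
Qed.

Lemma tenslin_measure_prepare_l m n p q (f : {linear 'M[C]_m -> 'M[C]_n})
    (g : {linear 'M[C]_p -> 'M[C]_q}) (I : finType) (w : I -> 'cV[C]_m) om :
  positive g -> (forall i, psdmx (om i)) -> f =1 measure_prepare w om ->
  positive (tenslin f g).
Proof.
move=> g0 om0 fE X X0.
have -> : tenslin f g X = \sum_i om i *t g (contractl (w i) X).
  elim/tensmx_ind: {X0} X => [|a X Y EX EY|A B].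
  - by rewrite linear0 big1 // => i _; rewrite !linear0 tensmx0.
  - rewrite (tenslin_is_linear f g a X Y) EX EY scaler_sumr -big_split.
    apply: eq_bigr => i _ /=; by rewrite !linearP tensmxDr tensmxZr.
  - rewrite tenslinE fE.
    rewrite (big_morph (fun Y => Y *t g B) (fun X Y => tensmxDl X Y _) (tens0mx _)).
    by apply: eq_bigr => i _; rewrite contractl_tens linearZ tensmxZl tensmxZr.
by apply: psdmx_sum => i; apply: psdmx_tens => //; apply/g0/psdmx_contractl.
Qed.

(** * Shifted maps: L- and L+ are the cases a = -1 and a = 1 *)

Definition trace_shift m n (Z : 'M[C]_n) (a : C) (f : {linear 'M[C]_m -> 'M[C]_n})
  (A : 'M[C]_m) : 'M[C]_n := \tr A *: Z + a *: f A.

Lemma trace_shift_is_linear m n Z a (f : {linear 'M[C]_m -> 'M[C]_n}) :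
  linear (trace_shift Z a f).
Proof.
move=> b A B; rewrite /trace_shift (linearP f) linearP scalerDl !scalerDr.
by rewrite addrACA !scalerA [a * b]mulrC.
Qed.

HB.instance Definition _ m n Z a (f : {linear 'M[C]_m -> 'M[C]_n}) :=
  GRing.isLinear.Build C 'M[C]_m 'M[C]_n _ (trace_shift Z a f)
    (trace_shift_is_linear Z a f).

(* Eigenvectors, of norm sqrt 2, of the Pauli matrices x (k = 0, 1) and y (k = 2, 3). *)
Definition phase_vec (k : 'I_4) : 'cV[C]_2 :=
  \col_i if i == 0 then 1 else ([:: 1; -1; 'i; - 'i]`_k)%R.

Lemma form2E (A : 'M[C]_2) (v : 'cV[C]_2) :
  (v^t* *m A *m v) 0 0 =
  ((v 0 0)^*%R * A 0 0 + (v 1 0)^*%R * A 1 0) * v 0 0 +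
  ((v 0 0)^*%R * A 0 1 + (v 1 0)^*%R * A 1 1) * v 1 0.
Proof.
have E1 : lift ord0 ord0 = 1 :> 'I_2 by apply/val_inj.
by rewrite !mxE !big_ord_recl !big_ord0 !mxE !big_ord_recl !big_ord0 !mxE E1 !addr0.
Qed.

(** In Bloch form the dephasings supply the x and y components and the flipped basis measurement
    minus the z component; the trace parts count 1 + 1 - 1. The factor 1/4 compensates the squared
    norms 2 in effect and state; [1 - i] in ['I_2] is the other index. *)
Lemma pauli_resolution (A : 'M[C]_2) :
  A = 4^-1 *: measure_prepare phase_vec (fun k => phase_vec k *m (phase_vec k)^t* ) A
      - measure_prepare (fun i => delta_mx i 0 : 'cV_2)
          (fun i => delta_mx (1 - i) (1 - i)) A.
Proof.
have i4 : (4 : C) != 0 by rewrite pnatr_eq0.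
have i2 := @sqrCi C.
have E1 : lift ord0 ord0 = 1 :> 'I_2 by apply/val_inj.
have ord2 (k : 'I_2) : k = 0 \/ k = 1.
  by case: k => [[|[|//]] ?]; [left|right]; apply/val_inj.
rewrite /measure_prepare !big_ord_recl !big_ord0 !form2E.
apply/matrixP => i j; rewrite !mxE !big_ord1 !mxE !E1 /=.
case: (ord2 i) => ->; case: (ord2 j) => -> /=.
all: rewrite !rmorphN /= !conjCi !(rmorph1, rmorph0) opprK.
all: apply: (mulfI i4); rewrite [RHS]mulrBr (mulVKf i4).
all: move: ('i%R : C) i2 => z i2; move: (A 0 0) (A 0 1) (A 1 0) (A 1 1) => a b c d.
all: ring: i2.
Qed.

Lemma trace_shift_measure_prepare n (f : {linear 'M[C]_2 -> 'M[C]_n}) (Z : 'M[C]_n) :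
  positive f -> positive (trace_shift Z (-1) f) ->
  exists (I : finType) (w : I -> 'cV[C]_2) (om : I -> 'M[C]_n),
    (forall i, psdmx (om i)) /\ trace_shift Z 1 f =1 measure_prepare w om.
Proof.
move=> f0 Zf0; exists ('I_4 + 'I_2)%type.
exists (fun s => match s with inl k => phase_vec k | inr i => delta_mx i 0 end).
exists (fun s => match s with
  | inl k => 4^-1 *: f (phase_vec k *m (phase_vec k)^t* )
  | inr i => trace_shift Z (-1) f (delta_mx (1 - i) (1 - i)) end).
split.
  case=> i; [apply/psdmxZ/f0|apply/Zf0].
  - by rewrite invr_ge0 ler0n.
  - by rewrite -{1}[phase_vec i]trmxCK; apply: psdmx_gram.
  - have := @psdmx_gram _ _ (delta_mx 0 (1 - i) : 'rV[C]_2).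
    by rewrite trmx_delta map_delta_mx mul_delta_mx.
move=> A; rewrite /trace_shift /measure_prepare big_sumType /=.
(* Writing Tr A in the computational basis merges Tr(A) Z with the subtracted terms of the
   resolution into the operators Z - f(|1-i><1-i|), positive by [Zf0]. *)
have -> : \tr A = \sum_i ((delta_mx i 0 : 'cV_2)^t* *m A *m (delta_mx i 0 : 'cV_2)) 0 0.
  by apply: eq_bigr => i _; rewrite trmx_delta map_delta_mx -rowE -colE !mxE.
rewrite scale1r [in X in _ + X](pauli_resolution A) linearB linearZ !linear_sum /=.
rewrite addrCA scaler_sumr scaler_suml -big_split; congr (_ + _); apply: eq_bigr => i _.
  by rewrite linearZ scalerA mulrC -scalerA.
by rewrite linearZ /= mxtrace_delta scale1r scaleN1r scalerBr.
Qed.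

(** The mixed terms Tr(.) Y (x) g and f (x) Tr(.) Z cancel between the two products. *)
Lemma tenslin_dominated m n p q (f : {linear 'M[C]_m -> 'M[C]_n})
    (g : {linear 'M[C]_p -> 'M[C]_q}) Y Z X :
  2 *: trace_shift (Y *t Z) (-1) (tenslin f g) X =
  tenslin (trace_shift Y (-1) f) (trace_shift Z 1 g) X +
  tenslin (trace_shift Y 1 f) (trace_shift Z (-1) g) X.
Proof.
elim/tensmx_ind: X => [|a X X' EX EX'|A B].
- by rewrite !linear0 addr0.
- rewrite !trace_shift_is_linear !tenslin_is_linear scalerDr scalerA [2 * a]mulrC.
  by rewrite -scalerA EX EX' scalerDr addrACA.
have -> : trace_shift (Y *t Z) (-1) (tenslin f g) (A *t B) =
    (\tr A * \tr B) *: (Y *t Z) - f A *t g B.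
  by rewrite /trace_shift mxtrace_tens scaleN1r -tenslinE.
rewrite (tenslinE (trace_shift Y (-1) f) (trace_shift Z 1 g)).
rewrite (tenslinE (trace_shift Y 1 f) (trace_shift Z (-1) g)) /trace_shift; apply/matrixP => i j; rewrite !mxE.
ring.
Qed.

(** * Communication value *)

Lemma ge0_ReK (z : C) : 0 <= z -> (complex.Re z)%:C = z.
Proof. by move=> z0; apply/RRe_real/ger0_real. Qed.

(** Chooses a decoder: [g y] is an input maximising [P y]. The initial value [P y ord0] is itself
    attained, which settles the base case. *)
Lemma classical_cv_attained n k (P : 'I_k -> 'I_n.+1 -> R) :
  exists g, classical_cv P = \sum_y P y (g y).
Proof.
have /choice[g gE] y : exists x, \big[Num.max/P y ord0]_(x < n.+1) P y x = P y x.
  elim/big_ind: _ => [|_ _ [x1 ->] [x2 ->]|x _]; [by exists ord0| |by exists x].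
  by case: (leP (P y x1) (P y x2)) => _; [exists x2|exists x1].
by exists g; apply: eq_bigr => y _.
Qed.

Lemma le_classical_cv n k (P : 'I_k -> 'I_n.+1 -> R) g :
  \sum_y P y (g y) <= classical_cv P.
Proof. by apply: ler_sum => y _; rewrite (bigD1 (g y)) //= le_max lexx. Qed.

Lemma cv_ge m n (f : {linear 'M[C]_m -> 'M[C]_n}) a k
    (rho : 'I_a.+1 -> 'M[C]_m) (Pi : 'I_k -> 'M[C]_n) g :
  (forall x, density (rho x)) -> povm Pi ->
  ((\sum_y transition f rho Pi y (g y))%:E <= cv f)%E.
Proof.
move=> rhoP PiP; apply: le_trans (_ : (classical_cv (transition f rho Pi))%:E <= _)%E.
  by rewrite lee_fin le_classical_cv.
by apply: ereal_sup_ubound; exists a, k, rho, Pi.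
Qed.

Lemma cv_le m n (f : {linear 'M[C]_m -> 'M[C]_n}) c :
  (forall a k (rho : 'I_a.+1 -> 'M[C]_m) (Pi : 'I_k -> 'M[C]_n) g,
    (forall x, density (rho x)) -> povm Pi ->
    \sum_y transition f rho Pi y (g y) <= c) -> (cv f <= c%:E)%E.
Proof.
move=> cP; apply: ge_ereal_sup => _ [a [k [rho [Pi [rhoP PiP ->]]]]].
have [g ->] := classical_cv_attained (transition f rho Pi).
by rewrite lee_fin cP.
Qed.

Lemma ReD (x y : C) : complex.Re (x + y) = complex.Re x + complex.Re y.
Proof. exact: raddfD. Qed.

Lemma Re_sum (I : finType) (F : I -> C) :
  complex.Re (\sum_i F i) = \sum_i complex.Re (F i).
Proof. exact: (big_morph _ ReD). Qed.

Lemma Re_le (x y : C) : x <= y -> complex.Re x <= complex.Re y.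
Proof. by rewrite lecE => /andP[]. Qed.

(** Weak duality: the effects sum to 1, so Tr Z is the sum of the Tr(Pi_y Z), each of which
    dominates Tr(Pi_y f(rho)) for every state rho. *)
Lemma cv_le_mxtrace m n (f : {linear 'M[C]_m -> 'M[C]_n}) (Z : 'M[C]_n) :
  positive (trace_shift Z (-1) f) -> (cv f <= (complex.Re (\tr Z))%:E)%E.
Proof.
move=> Zf; apply: cv_le => a k rho Pi g rhoP [Pi0 Pi1].
rewrite -[Z]mul1mx -Pi1 mulmx_suml (raddf_sum (@mxtrace C n)) Re_sum.
apply: ler_sum => y _.
apply: Re_le; rewrite -subr_ge0 -raddfB -mulmxBr; apply: psdmx_mxtrace_mul => //.
have [rho0 rho1] := rhoP (g y).
by have := Zf _ rho0; rewrite /trace_shift rho1 scale1r scaleN1r.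
Qed.

Lemma density_compl (A : 'M[C]_2) : density A -> density (1%:M - A).
Proof.
move=> [A0 trA]; split; first by have := psdmx_mxtrace_sub A0; rewrite trA scale1r.
by rewrite raddfB /= mxtrace1 trA; ring.
Qed.

Lemma cv_antipodal n (f : {linear 'M[C]_2 -> 'M[C]_n}) (c : R)
    (A : 'M[C]_2) (B : 'M[C]_n) :
  completely_positive f -> trace_preserving f -> (cv f <= c%:E)%E ->
  density A -> psdmx B -> psdmx (1%:M - B) ->
  1 + 2 * \tr (B *m f A) - \tr (B *m f 1%:M) <= c%:C.
Proof.
move=> cpf tpf fc Ad B0 B1.
pose rho (x : 'I_2) := if x == 0 then A else 1%:M - A.
pose Pi (y : 'I_2) := if y == 0 then B else 1%:M - B.
have rhoP x : density (rho x) by rewrite /rho; case: ifP => _ //; exact: density_compl.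
have PiP : povm Pi.
  split=> [y|]; first by rewrite /Pi; case: ifP.
  by rewrite big_ord_recl big_ord1 /Pi /= addrC subrK.
have [A0 trA] := Ad; have [A'0 _] := density_compl Ad.
(* Decoder [id]: the effect [B] guesses [A], and 1 - B guesses 1 - A. *)
have := le_trans (cv_ge f id rhoP PiP) fc.
rewrite lee_fin big_ord_recl big_ord1 /transition /rho /Pi /= -ReD -lecR.
(* The success terms are nonnegative, so taking real parts loses nothing. *)
rewrite ge0_ReK; last first.
  apply: addr_ge0; first exact: (psdmx_mxtrace_mul B0 (cp_psdmx cpf A0)).
  exact: (psdmx_mxtrace_mul B1 (cp_psdmx cpf A'0)).
congr (_ <= _).
have -> : f (1%:M - A) = f 1%:M - f A by exact: linearB.
rewrite mulmxBl mul1mx mulmxBr !(raddfB (@mxtrace C n)) /= !tpf mxtrace1 trA.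
ring.
Qed.

Lemma gram_gt0 n (v : 'cV[C]_n) : v != 0 -> 0 < (v^t* *m v) 0 0.
Proof.
have -> : (v^t* *m v) 0 0 = \sum_i `|v i 0| ^+ 2.
  by rewrite mxE; apply: eq_bigr => i _; rewrite !mxE normCK mulrC.
move=> v0; rewrite lt_def sumr_ge0 => [|i _]; last exact: exprn_ge0.
rewrite andbT; apply: contra_neq v0 => /psumr_eq0P v0.
apply/colP => i; rewrite mxE; apply/normr0_eq0/eqP.
by rewrite -sqrf_eq0 v0 // => j _; rewrite exprn_ge0.
Qed.

Lemma trace_shift_optimal (f : {linear 'M[C]_2 -> 'M[C]_2}) (c : R) :
  completely_positive f -> trace_preserving f -> (cv f <= c%:E)%E ->
  exists Z : 'M[C]_2, \tr Z = c%:C /\ positive (trace_shift Z (-1) f).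
Proof.
move=> cpf tpf fc; pose Z : 'M[C]_2 := 2^-1 *: f 1%:M + ((c%:C - 1) / 2) *: 1%:M.
have trZ : \tr Z = c%:C.
  by rewrite raddfD /= !mxtraceZ tpf mxtrace1; field.
exists Z; split; first exact: trZ.
move=> A A0.
(* Trace zero forces A = 0; otherwise [A] can be normalised to a state. *)
have [trA|trA] := eqVneq (\tr A) 0.
  by rewrite (psdmx_tr0 A0 trA) linear0 => v; rewrite mulmx0 mul0mx mxE.
have trA0 : 0 <= \tr A by apply: sumr_ge0 => i _; exact: psdmx_diag.
pose A1 : 'M[C]_2 := (\tr A)^-1 *: A.
have A1d : density A1.
  split; first by apply: psdmxZ; rewrite ?invr_ge0.
  by rewrite mxtraceZ mulVf.
have -> : A = \tr A *: A1 by rewrite scalerA divff ?scale1r.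
rewrite linearZ; apply: (psdmxZ trA0) => v.
rewrite /= /trace_shift A1d.2 scale1r scaleN1r.
have [->|v0] := eqVneq v 0; first by rewrite mulmx0 mxE.
have vv := gram_gt0 v0.
(* The projector onto the line of [v]; its trace 1 gives Tr(B Z) = Tr(B f(1)) / 2 + (c - 1) / 2. *)
pose B : 'M[C]_2 := ((v^t* *m v) 0 0)^-1 *: (v *m v^t* ).
have trB : \tr B = 1 by rewrite mxtraceZ mxtrace_mulC /mxtrace big_ord1 mulVf ?gt_eqF.
have B0 : psdmx B.
  apply: psdmxZ; first by rewrite invr_ge0 ltW.
  by have := psdmx_gram (v^t* ); rewrite trmxCK.
have B1 : psdmx (1%:M - B) by have := psdmx_mxtrace_sub B0; rewrite trB scale1r.
have -> : (v^t* *m (Z - f A1) *m v) 0 0 = (v^t* *m v) 0 0 * \tr (B *m (Z - f A1)).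
  rewrite -scalemxAl mxtraceZ mulVKf ?gt_eqF // -[in RHS]mulmxA mxtrace_mulC.
  by rewrite /mxtrace big_ord1.
rewrite pmulr_rge0 //; have := cv_antipodal cpf tpf fc A1d B0 B1.
clearbody B; rewrite mulmxBr raddfB /= mulmxDr -!scalemxAr mulmx1 raddfD /= !mxtraceZ trB.
(* Half of the antipodal inequality is exactly Tr(B (Z - f(A1))) >= 0. *)
rewrite -subr_ge0 => h.
have := mulr_ge0 (_ : 0 <= 2^-1) h; rewrite invr_ge0 ler0n => /(_ isT).
by congr (_ <= _); field.
Qed.

(** The trivial measurement gives 1 from below. From above, Z = 1 is an upper bound, since Tr(A) -
    f(A) = Tr(f(A)) - f(A) is positive in dimension two. *)
Lemma cv_fin_num (f : {linear 'M[C]_2 -> 'M[C]_2}) :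
  completely_positive f -> trace_preserving f ->
  exists2 c : R, 1 <= c & cv f = c%:E.
Proof.
move=> cpf tpf.
have lb : (1 <= cv f)%E.
  pose rho (x : 'I_1) : 'M[C]_2 := 2^-1 *: 1%:M.
  pose Pi (y : 'I_1) : 'M[C]_2 := 1%:M.
  have rhoP x : density (rho x).
    split; first by apply: psdmxZ; [rewrite invr_ge0 ler0n|exact: psdmx1].
    by rewrite mxtraceZ mxtrace1 mulVf // pnatr_eq0.
  have PiP : povm Pi by split; [move=> y; exact: psdmx1|rewrite big_ord1].
  have := cv_ge f id rhoP PiP.
  by rewrite big_ord1 /transition mul1mx tpf (rhoP _).2.
have ub : (cv f <= 2%:E)%E.
  have -> : 2 = complex.Re (\tr (1%:M : 'M[C]_2)) by rewrite mxtrace1 [in RHS]mulr2n ReD.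
  apply: cv_le_mxtrace => A A0; rewrite /trace_shift scaleN1r -(tpf A).
  exact/psdmx_mxtrace_sub/cp_psdmx.
case: (cv f) lb ub => // c; rewrite !lee_fin => c1 _; by exists c.
Qed.

(** Product code: product states, product effects, and a decoder acting on each component
    separately. *)
Lemma cv_tens_ge m n p q (f : {linear 'M[C]_m -> 'M[C]_n})
    (g : {linear 'M[C]_p -> 'M[C]_q}) a k b l
    (rho : 'I_a.+1 -> 'M[C]_m) (Pi : 'I_k -> 'M[C]_n)
    (sigma : 'I_b.+1 -> 'M[C]_p) (Xi : 'I_l -> 'M[C]_q) :
  completely_positive f -> completely_positive g ->
  (forall x, density (rho x)) -> povm Pi ->
  (forall x, density (sigma x)) -> povm Xi ->
  ((classical_cv (transition f rho Pi) * classical_cv (transition g sigma Xi))%:E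
     <= cv (tenslin f g))%E.
Proof.
move=> cpf cpg rhoP [Pi0 Pi1] sigmaP [Xi0 Xi1].
have [u ->] := classical_cv_attained (transition f rho Pi).
have [v ->] := classical_cv_attained (transition g sigma Xi).
pose tau (z : 'I_(a.+1 * b.+1)) :=
  rho (mxtens_unindex z).1 *t sigma (mxtens_unindex z).2.
pose Om (y : 'I_(k * l)) := Pi (mxtens_unindex y).1 *t Xi (mxtens_unindex y).2.
pose w (y : 'I_(k * l)) : 'I_(a.+1 * b.+1) :=
  mxtens_index (u (mxtens_unindex y).1, v (mxtens_unindex y).2).
have tauP z : density (tau z).
  have [r0 r1] := rhoP (mxtens_unindex z).1.
  have [s0 s1] := sigmaP (mxtens_unindex z).2.
  by split; [exact: psdmx_tens|rewrite mxtrace_tens r1 s1 mulr1].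
have OmP : povm Om.
  split=> [y|]; first exact: psdmx_tens.
  apply/matrixP => i j; rewrite summxE.
  under eq_bigr do rewrite mxE.
  rewrite -(mulr_sum (fun y => Pi y _ _) (fun z => Xi z _ _)) -!summxE Pi1 Xi1 !mxE.
  by rewrite -natrM mulnb -xpair_eqE -!surjective_pairing (can_eq (@mxtens_unindexK _ _)).
suff -> : (\sum_y transition f rho Pi y (u y)) * (\sum_y transition g sigma Xi y (v y))
    = \sum_y @transition R (m * p) (n * q) (a.+1 * b.+1) (k * l)
                (tenslin f g) tau Om y (w y).
  (* [cv_ge] takes the predecessor of the alphabet size, and [a.+1 * b.+1] is
     [(b + a * b.+1).+1]. *)
  exact: (@cv_ge _ _ _ (b + a * b.+1)%N).
rewrite mulr_sum; apply: eq_bigr => y _; rewrite /transition /tau /w mxtens_indexK /=.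
rewrite tenslinE tensmx_mul mxtrace_tens.
set s := \tr (Pi _ *m _); set t := \tr (Xi _ *m _).
have s0 : 0 <= s.
  by apply: psdmx_mxtrace_mul => //; apply: cp_psdmx => //; exact: (rhoP _).1.
have t0 : 0 <= t.
  by apply: psdmx_mxtrace_mul => //; apply: cp_psdmx => //; exact: (sigmaP _).1.
(* The real part is multiplicative here because both traces are real. *)
by apply: complexI; rewrite rmorphM /= !ge0_ReK // mulr_ge0.
Qed.

(** Divide by [b] and bound the supremum of [A], then divide by its member [x] and bound that of
    [B]; the second division needs [x] positive and finite. *)
Lemma mule_ereal_sup_le (A B : set (\bar R)) (a b : R) (T : \bar R) :
  0 < a -> 0 < b -> ereal_sup A = a%:E -> ereal_sup B = b%:E ->
  (forall x y, A x -> B y -> (x * y <= T)%E) -> ((a * b)%:E <= T)%E.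
Proof.
move=> a0 b0 Aa Bb AB.
have /ereal_sup_gt[x0 Ax0 x0_gt0] : (0 < ereal_sup A)%E by rewrite Aa lte_fin.
have /ereal_sup_gt[y0 By0 y0_gt0] : (0 < ereal_sup B)%E by rewrite Bb lte_fin.
(* Positive members of both sets give T >= 0, which disposes of the nonpositive [x] below. *)
have T0 : (0 <= T)%E by apply: le_trans (AB _ _ Ax0 By0); rewrite mule_ge0 // ltW.
rewrite EFinM muleC -lee_pdivlMl // -Aa; apply: ge_ereal_sup => x Ax.
have [x_gt0|x_le0] := ltP 0%E x; last first.
  by apply: le_trans x_le0 _; rewrite mule_ge0 // lee_fin invr_ge0 ltW.
rewrite lee_pdivlMl // muleC.
have: (x <= a%:E)%E by rewrite -Aa; exact: ereal_sup_ubound.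
case: x x_gt0 Ax => // r r0 Ar _.
rewrite -lee_pdivlMl // -Bb; apply: ge_ereal_sup => y By.
by rewrite lee_pdivlMl // AB.
Qed.

End CommunicationValue.

Theorem theorem5 (R : realType)
    (M N : {linear 'M[R[i]%C]_2 -> 'M[R[i]%C]_2}) :
  cptp M -> cptp N -> cv (tenslin M N) = (cv M * cv N)%E.
Proof.
move=> [cpM tpM] [cpN tpN].
have [a a1 Ma] := cv_fin_num cpM tpM; have [b b1 Nb] := cv_fin_num cpN tpN.
rewrite Ma Nb -EFinM; apply/eqP; rewrite eq_le; apply/andP; split.
  (* Upper bound: optimal bounds [Y] and [Z] of traces [a] and [b] give the bound Y (x) Z of trace
     [a * b]. *)
  have [|Y [trY Y0]] := @trace_shift_optimal _ M a cpM tpM; first by rewrite Ma.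
  have [|Z [trZ Z0]] := @trace_shift_optimal _ N b cpN tpN; first by rewrite Nb.
  have -> : a * b = complex.Re (\tr (Y *t Z)) by rewrite mxtrace_tens trY trZ -rmorphM.
  apply: cv_le_mxtrace => X X0.
  have M0 : positive M by move=> A; exact: cp_psdmx.
  have N0 : positive N by move=> A; exact: cp_psdmx.
  have [I [w [om [om0 wM]]]] := trace_shift_measure_prepare M0 Y0.
  have [J [v [et [et0 vN]]]] := trace_shift_measure_prepare N0 Z0.
  have -> : trace_shift (Y *t Z) (-1) (tenslin M N) X =
      2^-1 *: (tenslin (trace_shift Y (-1) M) (trace_shift Z 1 N) X
               + tenslin (trace_shift Y 1 M) (trace_shift Z (-1) N) X).
    by rewrite -tenslin_dominated scalerA mulVf ?pnatr_eq0 // scale1r.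
  apply: psdmxZ; first by rewrite invr_ge0 ler0n.
  apply: psdmxD.
    exact: (tenslin_measure_prepare_r Y0 et0 vN).
  exact: (tenslin_measure_prepare_l Z0 om0 wM).
(* Lower bound: any two codes combine into a product code; [a] and [b] are positive, being at least
   1. *)
apply: (mule_ereal_sup_le _ _ Ma Nb); rewrite ?(lt_le_trans ltr01) //.
move=> _ _ [m [k [rho [Pi [rhoP PiP ->]]]]] [n [l [sigma [Xi [sigmaP XiP ->]]]]].
by rewrite -EFinM cv_tens_ge.
Qed.
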